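(* Let $m,n\geq 2$ be natural numbers with $\omega(m)=\omega(n)=r$, with prime factorizations $n=p_1^{\alpha_1}p_2^{\alpha_2}\cdots p_r^{\alpha_r}$ and $m=q_1^{\beta_1}q_2^{\beta_2}\cdots q_r^{\beta_r}$, where $p_1,\dots,p_r$ are distinct primes, $q_1,\dots,q_r$ are distinct primes, and all $\alpha_i,\beta_i$ are positive integers. Then $$D(n||m)=H(m)-H(n)+\sum_{i=1}^{r}\left(\frac{\beta_i}{\Omega(m)}-\frac{\alpha_i}{\Omega(n)}\right)\log \beta_i .$$
   Context: $\log$ is the natural logarithm. For $n=p_1^{\alpha_1}\cdots p_r^{\alpha_r}\geq 2$ (distinct primes $p_i$, exponents $\alpha_i\geq 1$), $\Omega(n)=\alpha_1+\dots+\alpha_r$, $\omega(n)=r$ is the number of distinct prime factors, and the entropy of $n$ is $$H(n)=-\sum_{i=1}^r\frac{\alpha_i}{\Omega(n)}\log\frac{\alpha_i}{\Omega(n)}.$$ For $n=p_1^{\alpha_1}\cdots p_r^{\alpha_r}$ and $m=q_1^{\beta_1}\cdots q_r^{\beta_r}$ with the same number $r$ of distinct prime factors (with the given orderings of the factors), the Kullback--Leibler divergence is $$D(n||m)=-\sum_{i=1}^r\frac{\alpha_i}{\Omega(n)}\log\frac{\beta_i/\Omega(m)}{\alpha_i/\Omega(n)}=\log\frac{\Omega(m)}{\Omega(n)}-\frac{1}{\Omega(n)}\sum_{i=1}^r\alpha_i\log\frac{\beta_i}{\alpha_i}.$$ *)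

(* Defs.v *)
From mathcomp Require Import all_boot all_order all_algebra.
From mathcomp Require Import reals exp.

Set Implicit Arguments.
Unset Strict Implicit.
Unset Printing Implicit Defensive.

Import GRing.Theory Num.Theory.
Local Open Scope ring_scope.

Definition prime_factorization (r n : nat) (p a : 'I_r -> nat) : Prop :=
  [/\ injective p, forall i, prime (p i), forall i, (0 < a i)%N
    & n = (\prod_(i < r) p i ^ a i)%N].

Definition omega (n : nat) : nat := size (primes n).

Definition Omega (n : nat) : nat := (\sum_(p <- primes n) logn p n)%N.

Definition prime_weight (R : realType) (n p : nat) : R :=
  (logn p n)%:R / (Omega n)%:R.

Definition entropy (R : realType) (n : nat) : R :=
  - \sum_(p <- primes n) prime_weight R n p * ln (prime_weight R n p).

(* The divergence depends on how the prime factors of n and m are matched up,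
   so the orderings p of the primes of n and q of the primes of m are
   arguments. *)
Definition KL_divergence (R : realType) (r n m : nat) (p q : 'I_r -> nat) : R :=
  - \sum_(i < r) prime_weight R n (p i) *
      ln (prime_weight R m (q i) / prime_weight R n (p i)).

(* Main.v *)
(* Writing a_i, b_i for the normalized exponents, D(n||m) = - H(n) - sum_i a_i log b_i
   and H(m) = - sum_i b_i log b_i, so D(n||m) - H(m) + H(n) = sum_i (b_i - a_i) log b_i.
   Replacing log b_i by log beta_i = log b_i + log Omega(m) does not change this sum,
   because sum_i a_i = sum_i b_i. *)
Require Import Defs.
From mathcomp Require Import all_boot all_order all_algebra.
From mathcomp Require Import reals exp.
From mathcomp Require Import ring.

Import GRing.Theory Num.Theory.
Local Open Scope ring_scope.

Lemma logn_prod_prime_powers {r : nat} (p a : 'I_r -> nat) (s : nat) :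
  (forall i, prime (p i)) -> prime s ->
  logn s (\prod_(i < r) p i ^ a i)%N = (\sum_(i < r) a i * (s == p i))%N.
Proof.
move=> p_prime s_prime.
have pos_exp i : (0 < p i ^ a i)%N by rewrite expn_gt0 prime_gt0.
(* [logn s] turns products into sums only for positive factors, so the induction over the product
   carries positivity along with the valuation. *)
pose K x y := (0 < x)%N /\ logn s x = y.
have [] // : K (\prod_(i < r) p i ^ a i)%N (\sum_(i < r) a i * (s == p i))%N.
apply: (big_ind2 K) => [|x1 x2 y1 y2 [x1_gt0 <-] [y1_gt0 <-]|i _].
- by split; rewrite ?logn1.
- by split; rewrite ?muln_gt0 ?x1_gt0 ?lognM.
- by split; rewrite // lognX logn_prime.
Qed.

Section PrimeFactorization.

Context {r n : nat} {p a : 'I_r -> nat}.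
Hypothesis fact_n : prime_factorization n p a.

Lemma logn_prime_factorization (i : 'I_r) : logn (p i) n = a i.
Proof.
case: fact_n => p_inj p_prime _ ->.
rewrite logn_prod_prime_powers // (bigD1 i) //= eqxx muln1 big1 ?addn0 // => j ji.
by rewrite (inj_eq p_inj) eq_sym (negbTE ji) muln0.
Qed.

(** Both lists are duplicate-free, so equal membership suffices. Each [p i] divides [n] because
    [a i] is positive; conversely, a prime divisor [s] has positive valuation, so some term
    [a i * (s == p i)] is nonzero. *)
Lemma perm_primes_factorization : perm_eq (primes n) [seq p i | i <- index_enum 'I_r].
Proof.
case: (fact_n) => p_inj p_prime a_gt0 nE.
apply: uniq_perm; rewrite ?primes_uniq ?map_inj_uniq ?index_enum_uniq // => s.
apply/idP/mapP => [sn | [i _ ->]]; last first.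
  by rewrite -logn_gt0 logn_prime_factorization.
have s_prime : prime s by move: sn; rewrite mem_primes => /and3P[].
move: sn; rewrite -logn_gt0 nE logn_prod_prime_powers // lt0n sum_nat_eq0.
case/forallPn => i; rewrite muln_eq0 negb_or => /andP[_].
by rewrite eqb0 negbK => /eqP ->; exists i; rewrite ?mem_index_enum.
Qed.

(** [primes n] is increasing while [p] may list the primes in any order, hence the commutative
    [op]. *)
Lemma big_primes_factorization (T : Type) (idx : T) (op : Monoid.com_law idx)
    (F : nat -> T) :
  \big[op/idx]_(s <- primes n) F s = \big[op/idx]_(i < r) F (p i).
Proof. by rewrite (perm_big _ perm_primes_factorization) big_map. Qed.

Lemma Omega_factorization : Omega n = (\sum_(i < r) a i)%N.
Proof.
rewrite /Omega big_primes_factorization.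
by apply: eq_bigr => i _; rewrite logn_prime_factorization.
Qed.

Lemma Omega_factorization_gt0 : (1 < n)%N -> (0 < Omega n)%N.
Proof.
(* If the exponents summed to zero they would all vanish, making [n] an empty product, equal to
   1. *)
move=> n_gt1; rewrite lt0n Omega_factorization sum_nat_eq0; apply/negP => /forallP a0.
case: fact_n n_gt1 => _ _ _ ->; rewrite big1 // => i _.
by rewrite (eqP (a0 i)).
Qed.

Lemma sum_weights_factorization (R : realType) :
  (1 < n)%N -> \sum_(i < r) (a i)%:R / (Omega n)%:R = 1 :> R.
Proof.
move=> n_gt1; rewrite -mulr_suml -natr_sum -Omega_factorization divff //.
by rewrite pnatr_eq0 -lt0n Omega_factorization_gt0.
Qed.

Lemma prime_weight_factorization (R : realType) (i : 'I_r) :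
  prime_weight R n (p i) = (a i)%:R / (Omega n)%:R.
Proof. by rewrite /prime_weight logn_prime_factorization. Qed.

Lemma entropy_factorization (R : realType) :
  entropy R n = - \sum_(i < r) (a i)%:R / (Omega n)%:R
                               * ln ((a i)%:R / (Omega n)%:R).
Proof.
rewrite /entropy big_primes_factorization; congr (- _).
by apply: eq_bigr => i _; rewrite prime_weight_factorization.
Qed.

End PrimeFactorization.

Theorem proposition2p1 (R : realType) (m n r : nat)
    (hm : (2 <= m)%N) (hn : (2 <= n)%N)
    (homm : omega m = r) (homn : omega n = r)
    (p alpha q beta : 'I_r -> nat)
    (hfn : prime_factorization n p alpha)
    (hfm : prime_factorization m q beta) :
  KL_divergence R n m p q =
    entropy R m - entropy R n
    + \sum_(i < r) ((beta i)%:R / (Omega m)%:R - (alpha i)%:R / (Omega n)%:R)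
                   * ln (beta i)%:R.
Proof.
have N_gt0 : 0 < (Omega n)%:R :> R by rewrite ltr0n (Omega_factorization_gt0 hfn).
have M_gt0 : 0 < (Omega m)%:R :> R by rewrite ltr0n (Omega_factorization_gt0 hfm).
have alpha_gt0 i : 0 < (alpha i)%:R :> R by case: hfn => _ _ h _; rewrite ltr0n.
have beta_gt0 i : 0 < (beta i)%:R :> R by case: hfm => _ _ h _; rewrite ltr0n.
rewrite (entropy_factorization hfn) (entropy_factorization hfm) /KL_divergence.
have sum_diff0 : \sum_(i < r) ((beta i)%:R / (Omega m)%:R
    - (alpha i)%:R / (Omega n)%:R) * ln (Omega m)%:R = 0 :> R.
  rewrite -mulr_suml sumrB (sum_weights_factorization hfn) //.
  by rewrite (sum_weights_factorization hfm) // subrr mul0r.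
(* Subtracting the zero sum replaces [ln (beta i)] by [ln (beta i) - ln (Omega m)]; once both sides
   are single sums, they agree term by term. *)
rewrite -[RHS]subr0 -[X in _ - X]sum_diff0 opprK -!sumrN -!big_split /=.
apply: eq_bigr => i _.
rewrite (prime_weight_factorization hfn) (prime_weight_factorization hfm).
(* With the logarithms of quotients expanded, the four remaining logarithms are atoms for [ring]. *)
by rewrite !ln_div ?posrE ?divr_gt0 //; ring.
Qed.
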